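(* For any constants $s,c>1$, the algorithm $\mathrm{LF}$ is not $c$-competitive with $s$-speed for minimizing the maximum delay factor (or the maximum weighted response time) in unicast scheduling of unit-time jobs.
   Context: Unicast scheduling of unit-time jobs: jobs $J_i$ arrive online at times $a_i$, each requiring $1$ unit of processing on a speed-$1$ server ($1/s$ time on a speed-$s$ server), and each processing satisfies exactly one job. Each job has a slack $S_i>0$ (deadline $a_i+S_i$); in the weighted setting instead a weight $w_i$. With finish time $f_i$, the delay factor of $J_i$ is $\max\{1,(f_i-a_i)/S_i\}$ and its weighted response time is $w_i(f_i-a_i)$; the objective is the maximum over jobs. The wait ratio of an unfinished job at time $t>a_i$ is $(t-a_i)/S_i$ (respectively the weighted wait $w_i(t-a_i)$). Algorithm $\mathrm{LF}$ (Longest delay First) at each time schedules the job with the largest current wait ratio (respectively weighted wait). An algorithm is $c$-competitive with $s$-speed if on every instance its objective with a speed-$s$ server is at most $c$ times the optimal offline objective with a speed-$1$ server. *)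

(* Defs.v *)
From HB Require Import structures.
From mathcomp Require Import all_boot all_order all_algebra.
From mathcomp Require Import classical_sets reals.

Set Implicit Arguments.
Unset Strict Implicit.
Unset Printing Implicit Defensive.

Import Order.TTheory GRing.Theory Num.Theory.
Local Open Scope classical_set_scope.
Local Open Scope ring_scope.

(* [param] is the slack of a job for the maximum delay factor, and its weight
   for the maximum weighted response time. *)
Record instance (R : realType) := Instance {
  njobs : nat;
  arrival : 'I_njobs -> R;
  param : 'I_njobs -> R;
  arrival_ge0 : forall i, 0 <= arrival i;
  param_gt0 : forall i, 0 < param i }.

Variant objective := MaxDelayFactor | MaxWeightedResponse.

Section Model.
Variable R : realType.
Implicit Types (o : objective) (preemptive : bool) (s c t : R) (I : instance R).

(* Wait ratio, respectively weighted wait, of job [i] at time [t]. *)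
Definition wait o I (i : 'I_(njobs I)) t : R :=
  match o with
  | MaxDelayFactor => (t - arrival i) / param i
  | MaxWeightedResponse => param i * (t - arrival i)
  end.

Definition job_cost o I (i : 'I_(njobs I)) (f : R) : R :=
  match o with
  | MaxDelayFactor => Num.max 1 ((f - arrival i) / param i)
  | MaxWeightedResponse => param i * (f - arrival i)
  end.

(* A piece (j, (u, v)) stands for: the server processes j during [u, v[. *)
Definition piece I : Type := ('I_(njobs I) * (R * R))%type.
Definition pjob I (p : piece I) := p.1.
Definition pstart I (p : piece I) := p.2.1.
Definition pend I (p : piece I) := p.2.2.

Definition schedule I : Type := seq (piece I).

(* The completion time of [i]; it is the end of the last piece of [i] since, in
   a feasible schedule, [i] has pieces, their lengths are positive, and they add
   up to exactly its processing time. The default value 0 is harmless because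
   all times are nonnegative. *)
Definition finish I (sigma : schedule I) (i : 'I_(njobs I)) : R :=
  \big[Num.max/0]_(p <- sigma | pjob p == i) pend p.

Record feasible preemptive s I (sigma : schedule I) : Prop := Feasible {
  piece_gt0 : forall p, p \in sigma -> pstart p < pend p;
  chronological : pairwise (fun p q => pend p <= pstart q) sigma;
  released : forall p, p \in sigma -> arrival (pjob p) <= pstart p;
  served : forall i : 'I_(njobs I),
    \sum_(p <- sigma | pjob p == i) (pend p - pstart p) = s^-1;
  unsplit : ~~ preemptive -> uniq [seq pjob p | p <- sigma] }.

Definition unfinished I (sigma : schedule I) t (i : 'I_(njobs I)) : Prop :=
  arrival i <= t < finish sigma i.

Definition longest o I (sigma : schedule I) t (j : 'I_(njobs I)) : Prop :=
  forall i, unfinished sigma t i -> wait o i t <= wait o j t.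

(* The server never idles while a job is unfinished. With preemption the job
   being processed has the largest wait at each time; without preemption, the
   choice is made each time the free server starts a job. Ties are broken
   arbitrarily. *)
Record LF_schedule o preemptive s I (sigma : schedule I) : Prop := LFSchedule {
  LF_feasible : feasible preemptive s sigma;
  LF_busy : forall t, (exists i, unfinished sigma t i) ->
    exists2 p, p \in sigma & pstart p <= t < pend p;
  LF_longest : forall p, p \in sigma ->
    if preemptive
    then forall t, pstart p <= t < pend p -> longest o sigma t (pjob p)
    else longest o sigma (pstart p) (pjob p) }.

Definition cost o I (sigma : schedule I) : R :=
  \big[Num.max/0]_(i < njobs I) job_cost o i (finish sigma i).

Definition opt o preemptive I : R :=
  inf [set cost o sigma | sigma in [set sigma : schedule I |
                                     feasible preemptive 1 sigma]].

Definition algorithm : Type := forall I, schedule I.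

Definition is_LF o preemptive s (A : algorithm) : Prop :=
  forall I, LF_schedule o preemptive s (A I).

(* [A] is c-competitive with s-speed; that [A I] is feasible at speed [s] is
   part of the notion. *)
Definition competitive o preemptive c s (A : algorithm) : Prop :=
  forall I, feasible preemptive s (A I) /\
            cost o (A I) <= c * opt o preemptive I.

End Model.

(* Main.v *)
(* Group [i] of jobs has slack [S i], which decreases geometrically in [i], and
   arrives as one burst of [S i] units of work (a constant times more for
   [i = 0]) at a time [a i] such that the jobs of group [i] have wait ratio
   [r i = 1 + i / (2 s)] when group [i + 1] arrives. LF starts no job of group
   [i + 1] before its ratio has reached [r i], as long as a job of group [i] is
   unfinished. Since all the work of group [i] has to be done after
   [a i + r (i - 1) * S i], some job of group [i] indeed lasts until
   [a (i + 1) + r i * S (i + 1)], even with speed [s]. Hence the last group has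
   ratio at least [r (K - 1)], which is unbounded. Offline, each group but the
   first is served at once on arrival, before the next group arrives, and the
   first group, whose slack is huge, is served at the end; the cost is bounded
   independently of the number of groups. *)
Require Import Defs.
From mathcomp Require Import all_boot all_order all_algebra.
From mathcomp Require Import reals.
From mathcomp Require Import classical_sets lra.
Import Order.TTheory GRing.Theory Num.Theory.
Local Open Scope ring_scope.

(** * Lateness forced on LF *)

Lemma pieces_length_le (R : realType) (I : instance R) (P : pred (piece I))
    (sigma : schedule I) (h B : R) :
  {in sigma, forall p, pstart p < pend p} ->
  pairwise (fun p q => pend p <= pstart q) sigma ->
  h <= B -> {in sigma, forall p, P p -> h <= pstart p /\ pend p <= B} ->
  \sum_(p <- sigma | P p) (pend p - pstart p) <= B - h.
Proof.
elim: sigma h => [|p sigma IH] h len_gt0 /=; first by rewrite big_nil subr_ge0.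
move=> /andP[/allP p_first chron] hB hP.
have len_gt0' : {in sigma, forall q, pstart q < pend q}.
  by move=> q qs; apply: len_gt0; rewrite inE qs orbT.
rewrite big_cons; case: ifP => Pp; last first.
  by apply: IH => // q qs; apply: hP; rewrite inE qs orbT.
have [hp pB] := hP p (mem_head _ _) Pp.
have -> : B - h = (pend p - h) + (B - pend p) by lra.
apply: lerD; first by rewrite lerD2l lerN2.
apply: IH => // q qs Pq; split; first exact: p_first.
by have [] := hP q _ Pq; rewrite // inE qs orbT.
Qed.

Lemma pend_le_finish (R : realType) (I : instance R) (sigma : schedule I)
    (p : piece I) : p \in sigma -> pend p <= finish sigma (pjob p).
Proof. by move=> ps; rewrite /finish; apply: le_bigmax_seq. Qed.

(** The witness is the last job of [A] to finish: all the work of [A] has to fit between [h] and its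
    finish time. *)
Lemma exists_late_job (R : realType) (preemptive : bool) (s : R)
    (I : instance R) (sigma : schedule I) (A : {set 'I_(njobs I)}) (h : R) :
  0 < s -> feasible preemptive s sigma -> (0 < #|A|)%N ->
  {in sigma, forall p, pjob p \in A -> h <= pstart p} ->
  exists2 j, j \in A & h + #|A|%:R / s <= finish sigma j.
Proof.
move=> s_gt0 [len_gt0 chron _ serv _] A_gt0 hA.
have /card_gt0P[j0 j0A] := A_gt0.
have [j jA j_max] := @arg_maxP _ _ _ j0 (mem A) (finish sigma) j0A.
(* The maximum provides [h <= B]; since the work of [A] is positive, [B] turns out to be the finish
   time. *)
exists j => //; set B := Num.max h (finish sigma j).
have : \sum_(p <- sigma | pjob p \in A) (pend p - pstart p) <= B - h.
  apply: pieces_length_le => // [|p ps pA]; first by rewrite le_max lexx.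
  split; first exact: hA.
  rewrite le_max; apply/orP; right.
  by apply: le_trans (pend_le_finish _ _ _ _ ps) _; apply: j_max.
have -> : \sum_(p <- sigma | pjob p \in A) (pend p - pstart p) = #|A|%:R / s.
  rewrite (partition_big (@pjob R I) (mem A)) //=.
  rewrite (eq_bigr (fun=> s^-1)) => [|i iA]; first by rewrite sumr_const mulr_natl.
  rewrite -(serv i); apply: eq_bigl => p.
  by case: eqP => [->|]; rewrite ?andbT ?andbF //.
have : 0 < #|A|%:R / s by rewrite divr_gt0 ?ltr0n.
by rewrite /B maxEle; case: ifP => _; lra.
Qed.

(* No job of group [i] is started before time [h i]: at an earlier time after
   [a i], some job of group [i - 1] is unfinished and has a larger wait. *)
Lemma LF_group_late (R : realType) (o : objective) (preemptive : bool) (s : R)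
    (I : instance R) (sigma : schedule I) (g : 'I_(njobs I) -> nat)
    (a S r h : nat -> R) (K : nat) :
  0 < s -> LF_schedule o preemptive s sigma ->
  (forall i, 0 < S i) ->
  (forall j, arrival j = a (g j)) ->
  (forall j t, wait o j t = (t - a (g j)) / S (g j)) ->
  (forall i, (i <= K)%N -> (0 < #|[set j | g j == i]|)%N) ->
  (forall i, a i <= a i.+1) ->
  (forall i, r i * S i <= a i.+1 - a i) ->
  h 0%N = a 0%N -> (forall i, h i.+1 = a i.+1 + r i * S i.+1) ->
  (forall i, (i < K)%N -> h i.+1 <= h i + #|[set j | g j == i]|%:R / s) ->
  exists2 j, g j = K & h K + #|[set j | g j == K]|%:R / s <= finish sigma j.
Proof.
move=> s_gt0 [feas _ long] S_gt0 arrE waitE n_gt0 a_mono ra h0 hS hstep.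
(* In both modes, only the choice at the start of a piece is used. *)
have {}long p : p \in sigma -> longest o sigma (pstart p) (pjob p).
  move=> ps; move: (long p ps); case: ifP => // _; apply.
  by rewrite lexx (piece_gt0 feas).
have rel p : p \in sigma -> a (g (pjob p)) <= pstart p.
  by move=> ps; rewrite -arrE (released feas).
have late i : (i <= K)%N -> {in sigma, forall p, g (pjob p) = i -> h i <= pstart p} ->
    exists2 j, g j = i & h i + #|[set j | g j == i]|%:R / s <= finish sigma j.
  move=> iK hi.
  have [||j] :=
    exists_late_job _ _ _ _ _ [set j | g j == i] (h i) s_gt0 feas.
  - exact: n_gt0.
  - by move=> p ps; rewrite inE => /eqP; apply: hi.
  by rewrite inE => /eqP gj lej; exists j.
suff gate i : (i <= K)%N -> {in sigma, forall p, g (pjob p) = i -> h i <= pstart p}.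
  by apply: late => //; apply: gate.
elim: i => [_ p ps gp|i IH iK p ps gp].
  by rewrite h0 -gp rel.
have [j gj hj] := late i (ltnW iK) (IH (ltnW iK)).
rewrite leNgt; apply/negP => p_early.
have := rel p ps; rewrite gp => ap.
have uj : unfinished sigma (pstart p) j.
  rewrite /unfinished arrE gj (le_trans (a_mono i) ap) /=.
  exact: lt_le_trans p_early (le_trans (hstep i iK) hj).
have := long p ps j uj; rewrite !waitE gj gp; apply/negP; rewrite -ltNge.
(* The ratio [r i] separates the two waits: group [i.+1] is below it before [h i.+1], and group [i]
   has reached it by [a i.+1]. *)
apply: (@lt_le_trans _ _ (r i)).
  by rewrite ltr_pdivrMr // ltrBlDl -hS.
by rewrite ler_pdivlMr // (le_trans (ra i)) // lerD2r.
Qed.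

(** * Offline schedules from start times *)

(** Each job forms a single unit piece, so sorting by start time gives a schedule valid in both
    modes. *)
Lemma feasible_of_starts (R : realType) (preemptive : bool) (I : instance R)
    (b : 'I_(njobs I) -> R) :
  (forall j, arrival j <= b j) ->
  (forall i j, i != j -> b i <= b j -> b i + 1 <= b j) ->
  exists2 sigma : schedule I, feasible preemptive 1 sigma &
    forall j, finish sigma j = b j + 1.
Proof.
move=> arr_b sep.
pose ord := sort (relpre b <=%O) (enum 'I_(njobs I)).
pose mk j : piece I := (j, (b j, b j + 1)).
have ord_uniq : uniq ord by rewrite sort_uniq enum_uniq.
have ord_in j : j \in ord by rewrite mem_sort mem_enum.
have sumord (T : Type) (idx : T) (op : T -> T -> T) (F : piece I -> T) j :
    \big[op/idx]_(p <- [seq mk i | i <- ord] | pjob p == j) F p = op (F (mk j)) idx.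
  rewrite big_map -big_filter.
  rewrite (_ : [seq i <- ord | _] = [:: j]) ?big_cons ?big_nil //.
  exact: filter_pred1_uniq.
exists [seq mk i | i <- ord]; last first.
  move=> j; rewrite /finish sumord /mk /pend /=; apply/max_idPl.
  by rewrite addr_ge0 // (le_trans (arrival_ge0 j)).
split.
- by move=> p /mapP[j _ ->]; rewrite /pstart /pend /= ltrDl.
- rewrite pairwise_map.
  have : pairwise (fun i j => (i != j) && (b i <= b j)) ord.
    rewrite pairwise_relI -uniq_pairwise ord_uniq /=.
    rewrite -(@sorted_pairwise _ (relpre b <=%O)); last first.
      by move=> y x z /=; apply: le_trans.
    by apply: sort_sorted => x y; apply: le_total.
  by apply: sub_pairwise => i j /andP[]; apply: sep.
- by move=> p /mapP[j _ ->]; apply: arr_b.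
- by move=> j; rewrite sumord /mk /pend /pstart /= addr0 invr1; lra.
- by move=> _; rewrite -map_comp map_id.
Qed.

(** * Instances and costs common to both objectives *)

Lemma instance_param_gt0 (R : realType) (o : objective) (T : finType)
    (S : T -> R) (S_gt0 : forall x, 0 < S x) (i : 'I_#|T|) :
  0 < (if o is MaxDelayFactor then S (enum_val i) else (S (enum_val i))^-1).
Proof. by case: o; rewrite ?invr_gt0. Qed.

(* The weight [S^-1] makes the weighted wait equal to the wait ratio for slack
   [S], so that both objectives share one adversary. *)
Definition slack_instance {R : realType} (o : objective) {T : finType}
    {a S : T -> R} (a_ge0 : forall x, 0 <= a x) (S_gt0 : forall x, 0 < S x) :
    instance R :=
  @Instance R #|T| (fun i => a (enum_val i)) _ (fun i => a_ge0 (enum_val i))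
    (@instance_param_gt0 R o T S S_gt0).

Lemma wait_slack_instance (R : realType) (o : objective) (T : finType)
    (a S : T -> R) (a_ge0 : forall x, 0 <= a x) (S_gt0 : forall x, 0 < S x)
    (j : 'I_(njobs (slack_instance o a_ge0 S_gt0))) (t : R) :
  wait o j t = (t - a (enum_val j)) / S (enum_val j).
Proof. by case: o j => j //=; rewrite mulrC. Qed.

Lemma wait_le_job_cost (R : realType) (o : objective) (I : instance R)
    (j : 'I_(njobs I)) (f : R) : wait o j f <= job_cost o j f.
Proof. by case: o => //=; rewrite le_max lexx orbT. Qed.

Lemma job_cost_le (R : realType) (o : objective) (I : instance R)
    (j : 'I_(njobs I)) (f C : R) :
  1 <= C -> wait o j f <= C -> job_cost o j f <= C.
Proof. by case: o => //= C1 wC; rewrite ge_max C1. Qed.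

Lemma opt_le (R : realType) (o : objective) (preemptive : bool)
    (I : instance R) (sigma : schedule I) (C : R) :
  feasible preemptive 1 sigma -> 0 <= C ->
  (forall j, job_cost o j (finish sigma j) <= C) -> opt o preemptive I <= C.
Proof.
move=> feas C0 leC; apply: (@le_trans _ _ (cost o sigma)); last first.
  by apply: bigmax_le => // j _.
apply: ge_inf; last by exists sigma.
by exists 0 => _ [tau _ <-]; apply: bigmax_ge_id.
Qed.

(** * The adversary *)

Lemma LF_adversary (R : realType) (o : objective) (preemptive : bool) (s : R)
    (N k : nat) : 1 < s -> 2 * s <= N%:R ->
  exists2 I : instance R, opt o preemptive I <= N%:R + 2 &
    forall sigma : schedule I, LF_schedule o preemptive s sigma ->
      1 + k%:R / (2 * s) <= cost o sigma.
Proof.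
move=> s_gt1 sN.
have s_gt0 : 0 < s by lra.
have N_gt0 : (0 < N)%N by rewrite -(ltr_nat R); lra.
(* Slacks are powers of [M], hence integers that can also count jobs. As [M] dominates [2 * s * r i]
   for [i <= K], each slack is small enough compared with the previous one for [rSS]. *)
pose K := k.+1; pose M := (N + K)%N.
have M_gt0 : (0 < M)%N by rewrite addn_gt0 N_gt0.
pose m i := (M ^ (K - i))%N.
have m_gt0 i : (0 < m i)%N by rewrite expn_gt0 M_gt0.
(* No earlier group delays group 0, so its work alone must last until [a 1 + r 0 * S 1 <= 2 * S 0];
   the factor [N >= 2 * s] ensures this. *)
pose n i := if i == 0%N then (N * m 0%N)%N else m i.
have n_gt0 i : (0 < n i)%N.
  by rewrite /n; case: ifP; rewrite ?muln_gt0 ?N_gt0 m_gt0.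
pose S i : R := (m i)%:R.
have S_gt0 i : 0 < S i by rewrite ltr0n.
have SM i : (i < K)%N -> S i = M%:R * S i.+1.
  by move=> iK; rewrite /S /m -natrM -expnS subnSK.
pose r i : R := 1 + i%:R / (2 * s).
have r_ge1 i : 1 <= r i by rewrite lerDl divr_ge0 //; lra.
have rS i : r i.+1 = r i + 1 / (2 * s).
  by rewrite /r -natr1; lra.
have rM i : (i <= K)%N -> 2 * s * r i <= M%:R.
  move=> iK; have : (i%:R : R) <= K%:R by rewrite ler_nat.
  by rewrite /r /M natrD mulrDr mulr1 mulrCA divff ?mulr1; nra.
pose a i : R := \sum_(l < i) r l * S l.
have a0 : a 0%N = 0 by rewrite /a big_ord0.
have aS i : a i.+1 = a i + r i * S i by rewrite /a big_ord_recr.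
have Sa i : S i <= a i.+1 - a i.
  by rewrite aS addrAC subrr add0r ler_peMl // ltW.
have a_mono : {homo a : i j / (i <= j)%N >-> i <= j}.
  apply: homo_leq => [x|y x z|i]; [exact: lexx|exact: le_trans|].
  by have := Sa i; have := S_gt0 i; lra.
have a_ge0 i : 0 <= a i by rewrite -a0 a_mono.
have rSS i : (i < K)%N -> r i * S i.+1 <= S i / (2 * s).
  move=> iK; rewrite ler_pdivlMr; last by lra.
  by rewrite (SM i) //; have := rM i (ltnW iK); have := S_gt0 i.+1; nra.
have a_le : a K.+1 <= 2 * S 0%N.
  (* This potential equals [2 * S 0] at 0 and never increases, because [r i * S i] at least halves
     at each step. *)
  have aux i : (i <= K)%N -> a i + 2 * (r i * S i) <= 2 * S 0%N.
    elim: i => [_|i IH iK]; first by rewrite a0 /r mul0r; lra.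
    have := IH (ltnW iK); rewrite aS.
    suff : 2 * (r i.+1 * S i.+1) <= r i * S i by lra.
    apply: (@le_trans _ _ (S i)); last by rewrite ler_peMl // ltW.
    have rM2 : 2 * r i.+1 <= M%:R.
      by have := rM i.+1 iK; have := r_ge1 i.+1; nra.
    by rewrite (SM i) // mulrA ler_wpM2r // ltW.
  have := aux K (leqnn K); rewrite aS.
  by have := S_gt0 K; have := r_ge1 K; nra.
pose T := {i : 'I_K.+1 & 'I_(n i)}.
pose grp (x : T) : nat := tag x.
have aT x : 0 <= a (grp x) by [].
have ST x : 0 < S (grp x) by [].
pose I := slack_instance o aT ST.
pose g (j : 'I_(njobs I)) : nat := grp (enum_val j).
have waitE (j : 'I_(njobs I)) t : wait o j t = (t - a (g j)) / S (g j).
  exact: wait_slack_instance.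
have cardg i : (i <= K)%N -> #|[set j | g j == i]| = n i.
  move=> iK; pose i' := @Ordinal K.+1 i iK.
  pose job (q : 'I_(n i')) :=
    enum_rank (Tagged (fun l : 'I_K.+1 => 'I_(n l)) q).
  rewrite -[RHS]card_ord -(card_imset _ (f := job)).
    congr #|pred_of_set _|; apply/setP => j; rewrite inE; apply/eqP/imsetP.
      rewrite /g /grp; case E: (enum_val j) => [l q] /= li.
      have li' : l = i' by apply: val_inj.
      subst l; exists q => //; apply: enum_val_inj.
      by rewrite enum_rankK; exact: E.
    by case=> q _ ->; rewrite /g /grp enum_rankK.
  by move=> q q' /enum_rank_inj /eqP; rewrite eq_Tagged => /eqP.
exists I; last first.
  move=> sigma LFs.
  pose h i : R := if i is l.+1 then a i + r l * S i else a 0%N.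
  have [|||||||j gj hj] := @LF_group_late R o preemptive s I sigma g a S r h K
    s_gt0 LFs S_gt0 _ waitE.
  - by [].
  - by move=> i iK; rewrite cardg.
  - by move=> i; apply: a_mono.
  - by move=> i; rewrite aS addrAC subrr add0r.
  - by [].
  - by [].
  - move=> [|i] iK; rewrite cardg 1?ltnW //.
      have := rSS 0%N iK; rewrite /h aS a0 /n /= natrM /r mul0r addr0 !mul1r !add0r.
      rewrite -/(S 0%N) => S1.
      have Sd : S 0%N / (2 * s) <= S 0%N.
        by rewrite ler_pdivrMr; have := S_gt0 0%N; nra.
      apply: (@le_trans _ _ (S 0%N + S 0%N)); first by lra.
      by rewrite ler_pdivlMr //; have := S_gt0 0%N; nra.
    (* Half of the work [S i.+1 / s] pays for the increase of the ratio by [1 / (2 * s)], the other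
       half for [r i.+1 * S i.+2]. *)
    have := rSS _ iK; rewrite /h aS rS /n /= -/(S i.+1).
    have -> : S i.+1 / s = 2 * (S i.+1 / (2 * s)) by rewrite invfM; lra.
    by rewrite !mulrDl -mulrA; lra.
  apply: (@le_trans _ _ (wait o j (finish sigma j))).
    rewrite waitE gj ler_pdivlMr //.
    have : 0 <= (#|[set j | g j == K]|%:R : R) / s by rewrite divr_ge0 // ltW.
    by move: hj; rewrite /h /K -/(r k); lra.
  apply: le_trans (wait_le_job_cost _ _ _ _ _) _.
  exact: le_bigmax.
(* Jobs of a group run in the order of their index; by [a K.+1] all groups but group 0 are done. *)
pose b (j : 'I_(njobs I)) : R :=
  (if g j == 0%N then a K.+1 else a (g j)) + (tagged (enum_val j))%:R.
have g_leK j : (g j <= K)%N by rewrite -ltnS; apply: ltn_ord.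
have b_le j : b j + 1 <= (if g j == 0%N then a K.+1 else a (g j)) + (n (g j))%:R.
  by rewrite /b -addrA lerD2l natr1 ler_nat; apply: ltn_ord.
have b_ge j : (if g j == 0%N then a K.+1 else a (g j)) <= b j.
  by rewrite lerDl.
have b_end j : g j != 0%N -> b j + 1 <= a (g j).+1.
  move=> gj; apply: le_trans (b_le j) _; rewrite /n (negPf gj).
  by have := Sa (g j); rewrite /S; lra.
have [|i j ij|sigma feas finE] := @feasible_of_starts R preemptive I b.
- move=> j; apply: le_trans (b_ge j); case: ifP => _; last exact: lexx.
  exact: (a_mono (g j) K.+1 (leqW (g_leK j))).
- have [gij|gij] := eqVneq (g i) (g j).
    rewrite /b gij lerD2l -addrA lerD2l natr1 !ler_nat => le_tag.
    rewrite ltn_neqAle le_tag andbT; apply: contra ij => /eqP tij.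
    apply/eqP/enum_val_inj.
    move: gij tij; rewrite /g /grp.
    case: (enum_val i) (enum_val j) => [x p] [y q] /= /val_inj xy.
    by subst y => /val_inj ->.
  move=> bij; have [gi0|gi0] := eqVneq (g i) 0%N.
    have gj0 : g j != 0%N by rewrite -gi0 eq_sym.
    have := b_ge i; rewrite gi0 eqxx; have := b_end j gj0.
    by have := a_mono (g j).+1 K.+1 (g_leK j); lra.
  apply: le_trans (b_end i gi0) _; apply: le_trans (b_ge j).
  case: ifP => [_|gj0]; first exact/a_mono/g_leK.
  apply: (a_mono); rewrite ltn_neqAle gij /= leqNgt; apply/negP => ji.
  have := b_end j (negbT gj0); have := b_ge i; rewrite (negPf gi0).
  by have := a_mono _ _ ji; lra.
apply: (opt_le _ _ _ _ sigma) => // [|j]; first by rewrite addr_ge0.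
have N0 : 0 <= N%:R :> R by [].
rewrite finE; apply: job_cost_le; first by lra.
(* Group 0 ends by [a K.+1 + N * S 0 <= (N + 2) * S 0]; all other jobs have ratio at most 1. *)
rewrite waitE ler_pdivrMr //; have [gj0|gj0] := eqVneq (g j) 0%N.
  have := b_le j; rewrite gj0 /= /n /= natrM -/(S 0%N) a0; lra.
have := b_le j; rewrite (negPf gj0) /n (negPf gj0) -/(S (g j)).
by have := S_gt0 (g j); nra.
Qed.

Theorem theorem3 (R : realType) (s c : R) (hs : 1 < s) (hc : 1 < c)
    (o : objective) (preemptive : bool) (LF : algorithm R)
    (hLF : is_LF o preemptive s LF) :
  ~ competitive o preemptive c s LF.
Proof.
move=> comp.
pose N := Num.bound (2 * s).
have sN : 2 * s <= N%:R by apply/ltW/archi_boundP; lra.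
(* The offline bound [N + 2] does not involve [k], so [k / (2 * s)] can be made to exceed [c] times
   it. *)
pose k := Num.bound (c * (N%:R + 2) * (2 * s)).
have [I optI costI] := LF_adversary R o preemptive s N k hs sN.
have [_ le_c] := comp I.
have := le_trans (costI _ (hLF I)) le_c; apply/negP; rewrite -ltNge.
have N0 : 0 <= N%:R :> R by [].
have ck : c * (N%:R + 2) < k%:R / (2 * s).
  by rewrite ltr_pdivlMr; last lra; apply: archi_boundP; rewrite !mulr_ge0; lra.
by nra.
Qed.
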